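(* Let $\mathcal{H}_1$ and $\mathcal{H}_2$ be two real Hilbert spaces, and let $C\subset\mathcal{H}_1$ and $Q\subset\mathcal{H}_2$ be nonempty, closed and convex subsets. Let $f:\mathcal{H}_1\to\mathbb{R}$ and $g:\mathcal{H}_2\to\mathbb{R}$ be two continuous functions. Let $\mathcal{B}_1:\mathcal{H}_1\to 2^{\mathcal{H}_1}$ and $\mathcal{B}_2:\mathcal{H}_2\to 2^{\mathcal{H}_2}$ be two strict weakly compact-valued and $H$-continuous mappings. Let $A:\mathcal{H}_1\to\mathcal{H}_2$ be a bounded linear operator. Then the split multivalued variational inequality problem (SMVIP) associated with these data is LP well-posed in the generalized sense if and only if $$S(\epsilon)\neq\emptyset \quad \forall\,\epsilon>0 \quad\text{and}\quad \mu(S(\epsilon))\to 0 \text{ as } \epsilon\to 0.$$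
   Context: Data: real Hilbert spaces $\mathcal{H}_1,\mathcal{H}_2$; sets $C\subset\mathcal{H}_1$, $Q\subset\mathcal{H}_2$; functions $f:\mathcal{H}_1\to\mathbb{R}$, $g:\mathcal{H}_2\to\mathbb{R}$; multivalued mappings $\mathcal{B}_i:\mathcal{H}_i\to 2^{\mathcal{H}_i}$ ($i=1,2$); a bounded linear operator $A:\mathcal{H}_1\to\mathcal{H}_2$. The product $\mathcal{H}_1\times\mathcal{H}_2$ carries its usual Hilbert space structure. A multivalued mapping is strict if all its values are nonempty. It is weakly compact-valued if each of its values is a weakly compact set. Hausdorff metric: for nonempty sets $M,N$ in a Hilbert space, $d(a,N)=\inf_{b\in N}\|a-b\|$, $D(M,N)=\sup_{a\in M}d(a,N)$, $H(M,N)=\max\{D(M,N),D(N,M)\}$. A strict weakly compact-valued mapping $B:\mathcal{H}\to 2^{\mathcal{H}}$ is $H$-continuous if for every $x\in\mathcal{H}$ and every $\epsilon>0$ there is $\delta>0$ such that $H(B(x),B(y))<\epsilon$ for all $y\in\mathcal{H}$ with $\|x-y\|<\delta$. SMVIP: find $(x^*,y^* )\in\mathcal{H}_1\times\mathcal{H}_2$ for which there exists $(u^*,v^* )\in\mathcal{B}_1(x^* )\times\mathcal{B}_2(y^* )$ such that $x^*\in C$, $y^*\in Q$, $y^*=Ax^*$, $\langle u^*,x^*-x\rangle+f(x^* )-f(x)\le 0$ for all $x\in C$, and $\langle v^*,y^*-y\rangle+g(y^* )-g(y)\le 0$ for all $y\in Q$. Its solution set is denoted by $S$. A sequence $\{(x_n,y_n)\}\subset\mathcal{H}_1\times\mathcal{H}_2$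 is a generalized approximating sequence for SMVIP if there exist $u_n\in\mathcal{B}_1(x_n)$, $v_n\in\mathcal{B}_2(y_n)$ and real numbers $\epsilon_n>0$ with $\epsilon_n\to0$ such that, for every $n$, $d(x_n,C)\le\epsilon_n$, $d(y_n,Q)\le\epsilon_n$, $\|y_n-Ax_n\|\le\epsilon_n$, $\langle u_n,x_n-x\rangle+f(x_n)-f(x)\le\epsilon_n$ for all $x\in C$, and $\langle v_n,y_n-y\rangle+g(y_n)-g(y)\le\epsilon_n$ for all $y\in Q$. SMVIP is LP (Levitin-Polyak) well-posed in the generalized sense if $S$ is nonempty and every generalized approximating sequence for SMVIP has a subsequence which converges (in norm) to some element of $S$. For $\epsilon>0$, $S(\epsilon)$ is the set of all $(z,w)\in\mathcal{H}_1\times\mathcal{H}_2$ such that $d(z,C)\le\epsilon$, $d(w,Q)\le\epsilon$, $\|w-Az\|\le\epsilon$, and there exist $u\in\mathcal{B}_1(z)$, $v\in\mathcal{B}_2(w)$ with $\langle u,z-x\rangle+f(z)-f(x)\le\epsilon$ for all $x\in C$ and $\langle v,w-y\rangle+g(w)-g(y)\le\epsilon$ for all $y\in Q$. The Kuratowski measure of noncompactness of a set $M$ is $\mu(M)=\inf\{\epsilon>0: M\subset\bigcup_{i=1}^n M_i \text{ for some } n\in\mathbb{N} \text{ and sets } M_i \text{ with } \operatorname{diam}(M_i)<\epsilon,\ i=1,\dots,n\}$ (equal to $+\infty$ if no such $\epsilon$ exists), where $\operatorname{diam}(M)=\sup\{\|a-b\|:a,b\in M\}$. *)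

(* Defs.v *)
From HB Require Import structures.
From mathcomp Require Import all_boot all_order all_algebra sesquilinear.
From mathcomp Require Import all_classical all_reals all_analysis.

Set Implicit Arguments.
Unset Strict Implicit.
Unset Printing Implicit Defensive.

Import Order.TTheory GRing.Theory Num.Theory.
Import numFieldNormedType.Exports.

Local Open Scope classical_set_scope.
Local Open Scope ring_scope.

(* [{dot H for idfun}] is the type of symmetric positive definite bilinear
   forms; a real Hilbert space is a complete normed space whose norm is induced
   by such a form. *)
HB.mixin Record CompleteNormedModule_isHilbert (R : realType) H
    of CompleteNormedModule R H := {
  inner : {dot H for (@idfun R)} ;
  inner_normE : forall x : H, `|x| = Num.sqrt (inner x x)
}.

#[short(type="hilbertType")]
HB.structure Definition Hilbert (R : realType) :=
  {H of CompleteNormedModule R H & CompleteNormedModule_isHilbert R H}.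

(* the coarsest topology making every norm-continuous linear form continuous *)
Definition weak_space (R : realType) (H : hilbertType R) : Type :=
  sup_topology (fun phi : {phi : {scalar H} | continuous (phi : H -> R)} =>
    Topological.class (initial_topology (sval phi : H -> R))).

HB.instance Definition _ (R : realType) (H : hilbertType R) :=
  Topological.on (weak_space H).

Section hilbert_space.
Context {R : realType} {H : hilbertType R}.
Implicit Types (x y a b : H) (M N : set H).

Definition weakly_compact (M : set H) := @compact (weak_space H) M.

(* The distances below are extended reals, so that no boundedness is implicitly
   assumed when taking suprema. *)
Definition dist_set x N : \bar R := ereal_inf [set `|x - b|%:E | b in N].

Definition hausdorff_excess M N : \bar R :=
  ereal_sup [set dist_set a N | a in M].

Definition hausdorff_dist M N : \bar R :=
  maxe (hausdorff_excess M N) (hausdorff_excess N M).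

Definition strict_map (B : H -> set H) := forall x, B x !=set0.

Definition weakly_compact_valued (B : H -> set H) :=
  forall x, weakly_compact (B x).

Definition H_continuous (B : H -> set H) :=
  forall x (e : R), 0 < e -> exists2 delta : R, 0 < delta &
    forall y, `|x - y| < delta -> (hausdorff_dist (B x) (B y) < e%:E)%E.

End hilbert_space.

Section hilbert_product.
Context {R : realType} {H1 H2 : hilbertType R}.

(* The library norm on [H1 * H2] is the maximum norm; these are the inner
   product and the norm of the Hilbert direct sum. *)
Definition prod_inner (p q : H1 * H2) : R :=
  inner p.1 q.1 + inner p.2 q.2.

Definition prod_norm (p : H1 * H2) : R := Num.sqrt (prod_inner p p).

(* [diam set0 = -oo], which does not affect [kuratowski] *)
Definition diam (M : set (H1 * H2)) : \bar R :=
  ereal_sup [set (prod_norm (p.1 - p.2))%:E | p in M `*` M].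

Definition kuratowski (M : set (H1 * H2)) : \bar R :=
  ereal_inf [set e%:E | e in [set e : R | 0 < e /\
    exists (n : nat) (F : 'I_n -> set (H1 * H2)),
      M `<=` \bigcup_i F i /\ forall i, (diam (F i) < e%:E)%E]].

End hilbert_product.

Definition bounded_operator {R : realType} {H1 H2 : hilbertType R}
    (A : {linear H1 -> H2}) :=
  exists k : R, forall x, `|A x| <= k * `|x|.

Section smvip.
Context {R : realType} {H1 H2 : hilbertType R}.
Variables (C : set H1) (Q : set H2) (f : H1 -> R) (g : H2 -> R).
Variables (B1 : H1 -> set H1) (B2 : H2 -> set H2) (A : {linear H1 -> H2}).

Definition smvip_sol : set (H1 * H2) := [set p |
  exists u v, [/\ B1 p.1 u, B2 p.2 v, C p.1, Q p.2 & p.2 = A p.1] /\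
    (forall x, C x -> inner u (p.1 - x) + f p.1 - f x <= 0) /\
    (forall y, Q y -> inner v (p.2 - y) + g p.2 - g y <= 0)].

Definition smvip_approx (e : R) : set (H1 * H2) := [set p |
  [/\ (dist_set p.1 C <= e%:E)%E, (dist_set p.2 Q <= e%:E)%E,
      `|p.2 - A p.1| <= e &
      exists u v, [/\ B1 p.1 u, B2 p.2 v,
        forall x, C x -> inner u (p.1 - x) + f p.1 - f x <= e &
        forall y, Q y -> inner v (p.2 - y) + g p.2 - g y <= e]]].

Definition generalized_approximating_seq (p : nat -> H1 * H2) :=
  exists (u : nat -> H1) (v : nat -> H2) (e : nat -> R),
    [/\ forall n, B1 (p n).1 (u n), forall n, B2 (p n).2 (v n),
        forall n, 0 < e n & e @ \oo --> (0 : R)] /\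
    forall n, [/\ (dist_set (p n).1 C <= (e n)%:E)%E,
      (dist_set (p n).2 Q <= (e n)%:E)%E,
      `|(p n).2 - A (p n).1| <= e n,
      forall x, C x ->
        inner (u n) ((p n).1 - x) + f (p n).1 - f x <= e n &
      forall y, Q y ->
        inner (v n) ((p n).2 - y) + g (p n).2 - g y <= e n].

Definition LP_well_posed_generalized :=
  smvip_sol !=set0 /\
  forall p, generalized_approximating_seq p ->
    exists2 k : nat -> nat, increasing_seq k &
    exists2 l, smvip_sol l &
      prod_norm (p (k n) - l) @[n --> \oo] --> (0 : R).

End smvip.

(* Main.v *)
From HB Require Import structures.
Require Import Defs.
From mathcomp Require Import all_boot all_order all_algebra sesquilinear.
From mathcomp Require Import all_classical all_reals all_analysis.
From mathcomp Require Import ring lra.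

Set Implicit Arguments.
Unset Strict Implicit.
Unset Printing Implicit Defensive.

Import Order.TTheory GRing.Theory Num.Theory.
Import numFieldNormedType.Exports.

(** Write S for the solution set and S(e) for the approximate solution sets,
    which increase with e and contain S.  A generalized approximating sequence
    is exactly a sequence p with p_n in S(e_n) for some positive e_n tending
    to 0 ([generalized_approximating_seqP]).  Since the sets S(e) are nested,
    the Kuratowski measure of S(e) tends to 0 if and only if, for every r > 0,
    some S(e) is a finite union of sets of diameter less than r
    ([kuratowski_cvg0P]).

    Suppose the problem is well-posed and that, for some r, no S(e) has such
    a cover.  Then finitely many balls of radius r/8 never cover S(1/(n+1)), so
    one can choose inductively p_n in S(1/(n+1)) at distance at least r/8 from
    p_0, ..., p_(n-1).  This is a generalized approximating sequence without
    convergent subsequence, a contradiction ([well_posed_small_cover]).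

    Conversely, let p_n be in S(e_n) with e_n tending to 0, and take an
    ultrafilter U on nat finer than the Frechet filter.  For every r one of the
    finitely many small sets covering S(e) contains p_n for U-almost all n;
    hence p is Cauchy along U and converges along U to some l, which is then
    the limit of a subsequence ([approx_subsequence]).

    The point to check is that l belongs to S ([approx_variational_limit]).
    The multipliers u_n in B(x_n) need not converge, but H-continuity of B
    gives w_n in B(x), x being the limit of x_n, with |u_n - w_n| tending to 0.
    The set B(x) is weakly compact, hence bounded by the uniform boundedness
    principle, and the w_n have a weak cluster point v in B(x).  The approximate
    inequalities pass to v, because <u_n, x_n - z> - <w_n, x - z> tends to 0 by
    the Cauchy-Schwarz inequality and boundedness of B(x). *)

Local Open Scope classical_set_scope.
Local Open Scope ring_scope.

(** * Inner products and weak compactness *)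

Section inner_product.
Context {R : realType} {H : hilbertType R}.
Implicit Types x y z : H.

Lemma innerC x y : inner x y = inner y x.
Proof. by rewrite hermC expr0 mul1r. Qed.

Lemma innerDl z x y : inner (x + y) z = inner x z + inner y z.
Proof. exact: linearDl. Qed.

Lemma innerBl z x y : inner (x - y) z = inner x z - inner y z.
Proof. exact: linearBl. Qed.

Lemma innerZl z a x : inner (a *: x) z = a * inner x z.
Proof. exact: linearZl_LR. Qed.

Lemma innerBr z x y : inner z (x - y) = inner z x - inner z y.
Proof. by rewrite innerC innerBl !(innerC z). Qed.

Lemma innerZr z a x : inner z (a *: x) = a * inner z x.
Proof. by rewrite innerC innerZl (innerC z). Qed.

Lemma inner_ge0 x : 0 <= inner x x.
Proof.
have [->|x0] := eqVneq x 0; first by rewrite -(scale0r x) innerZl mul0r.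
exact/ltW/neq0_dnorm_gt0.
Qed.

Lemma inner_sqr x : inner x x = `|x| ^+ 2.
Proof. by rewrite inner_normE sqr_sqrtr ?inner_ge0. Qed.

Lemma cauchy_schwarz x y : `|inner x y| <= `|x| * `|y|.
Proof.
have [->|y0] := eqVneq y 0.
  by rewrite -(scale0r x) innerZr mul0r normr0 mulr_ge0.
have yy0 : 0 < inner y y by exact: neq0_dnorm_gt0.
rewrite -ler_sqr ?nnegrE ?mulr_ge0// real_normK ?num_real// exprMn -!inner_sqr.
(* up to the factor [inner y y], this is [x] minus its projection on [y] *)
have := inner_ge0 (inner y y *: x - inner x y *: y).
rewrite innerBl !innerBr !innerZl !innerZr (innerC y x) => h.
rewrite -subr_ge0 -(pmulr_rge0 _ yy0).
by apply: le_trans h _; rewrite le_eqVlt; apply/orP; left; apply/eqP; ring.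
Qed.

(** The linear form [w |-> <w, z>], the variable being on the left. *)
Definition inner_form (z : H) : H -> R := fun w => inner w z.

Lemma inner_form_linear z : linear (inner_form z).
Proof. by move=> a x y; rewrite /inner_form innerDl innerZl. Qed.

HB.instance Definition _ z :=
  GRing.isLinear.Build R H R *%R (inner_form z) (inner_form_linear z).

Lemma inner_form_continuous z : continuous (inner_form z).
Proof.
move=> x; apply/cvgrPdist_lt => e e0; near=> y.
rewrite /inner_form -innerBl (le_lt_trans (cauchy_schwarz _ _))//.
have K0 : 0 < `|z| + 1 by rewrite ltr_wpDl.
apply: (@le_lt_trans _ _ (`|x - y| * (`|z| + 1))).
  by rewrite ler_wpM2l// lerDl.
rewrite -ltr_pdivlMr//; near: y; apply: cvgr_dist_lt; first exact: cvg_id.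
exact: divr_gt0.
Unshelve. all: by end_near. Qed.

Lemma inner_form_weak_continuous z :
  continuous (inner_form z : weak_space H -> R).
Proof.
move=> u.
pose phi : {phi : {scalar H} | continuous (phi : H -> R)} :=
  exist _ (inner_form z : {scalar H}) (@inner_form_continuous z).
have h := (cvg_sup _ _ (nbhs_filter (u : weak_space H))).1 cvg_id phi.
by move=> A Au; apply: h; exact: (@initial_continuous H R (inner_form z) u A Au).
Qed.

(** Each form [w |-> <w, z>] is bounded on a weakly compact set, so the forms [inner w]
    with [w] in the set are pointwise, hence uniformly, bounded. *)
Lemma weakly_compact_bounded (M : set H) : weakly_compact M ->
  exists K : R, forall w, M w -> `|w| <= K.
Proof.
move=> Mc.
pose F : set (H -> R^o) := [set inner w | w in M].
have /(_ _ _ 1)[|z|K hK] := @Banach_Steinhauss R H R^o F.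
- move=> _ [w Mw <-]; split.
    move=> r; exists (`|w| * r) => x xr.
    by rewrite (le_trans (cauchy_schwarz _ _))// ler_wpM2l.
  by move=> a x y; rewrite innerC innerDl innerZl !(innerC _ w).
- have : compact (inner_form z @` M).
    apply: (@continuous_compact (weak_space H) R (inner_form z)) => //.
    exact/continuous_subspaceT/inner_form_weak_continuous.
  move=> /compact_bounded[N [_ hN]]; exists (N + 1) => _ [w Mw <-].
  by apply: (hN (N + 1)); [rewrite ltrDl|exists w].
- exists K => w Mw; have [->|w0] := eqVneq w 0.
    rewrite normr0.
    have /(_ 0) := hK _ (ex_intro2 _ _ w Mw erefl).
    by rewrite normr0 ler01 => /(_ isT); apply: le_trans.
  have nw0 : 0 < `|w| by rewrite normr_gt0.
  (* the form [inner w] takes the value [`|w|] at the unit vector of [w] *)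
  have /(_ (`|w|^-1 *: w)) := hK _ (ex_intro2 _ _ w Mw erefl).
  rewrite normrZ normfV normr_id mulVf ?gt_eqF// lexx => /(_ isT).
  by rewrite innerZr inner_sqr expr2 mulKf ?gt_eqF// normr_id.
Qed.

(** Half-spaces are weakly closed. *)
Lemma weak_cluster_inner_le {I : Type} (F : set_system I) {FF : ProperFilter F}
    (w : I -> H) (u z : H) (c : R) :
  @cluster (weak_space H) (w @ F) u ->
  (\forall i \near F, inner (w i) z <= c) -> inner u z <= c.
Proof.
move=> clu wc; rewrite leNgt; apply/negP => cu.
have cuN : nbhs (u : weak_space H) [set v | c < inner_form z v].
  have zu := @inner_form_weak_continuous z u.
  exact: (@cvgr_gt _ _ _ (nbhs_filter (u : weak_space H)) _ _ zu c cu).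
have [v [/=]] := clu [set v : H | inner v z <= c] _ wc cuN.
by rewrite /inner_form ltNge => ->.
Qed.

End inner_product.

(** * Limits of approximate solutions *)

Section limits.
Context {R : realType} {H : hilbertType R}.
Context {I : Type} (F : set_system I) {FF : ProperFilter F}.
Implicit Types (x : H) (C : set H) (B : H -> set H).

Lemma dist_set_ltP x C (r : R) :
  (dist_set x C < r%:E)%E -> exists2 b, C b & `|x - b| < r.
Proof.
by move=> /ereal_inf_lt[_ [b Cb <-]]; rewrite lte_fin => xb; exists b.
Qed.

Lemma dist_set_cvg0_mem (x_ : I -> H) (e : I -> R) x C : closed C ->
  (forall i, (dist_set (x_ i) C <= (e i)%:E)%E) -> e i @[i --> F] --> 0 ->
  x_ i @[i --> F] --> x -> C x.
Proof.
move=> Ccl xC e0 xx; apply: Ccl => A /nbhs_ballP[r /= r0 rA].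
have r20 : 0 < r / 2 by rewrite divr_gt0.
have /filter_ex[i [er xr]] : \forall i \near F, e i < r / 2 /\ `|x - x_ i| < r / 2.
  by apply: filterI; [exact: cvgr_lt e0 _ r20|exact: cvgr_dist_lt xx _ r20].
have [|b Cb xb] := @dist_set_ltP (x_ i) C (r / 2).
  by rewrite (le_lt_trans (xC i))// lte_fin.
exists b; split => //; apply: rA; rewrite -ball_normE /=.
by rewrite [r]splitr (le_lt_trans (ler_distD (x_ i) _ _))// ltrD.
Qed.

(** Points of [B (x_ i)] are asymptotically close to points of [B x]; the
    slack [e i] compensates for the distance to [B x] being only an infimum. *)
Lemma H_continuous_selection B (x_ u : I -> H) (e : I -> R) x :
  H_continuous B -> strict_map B ->
  (forall i, B (x_ i) (u i)) -> (forall i, 0 < e i) ->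
  e i @[i --> F] --> 0 -> x_ i @[i --> F] --> x ->
  exists2 w : I -> H, forall i, B x (w i) & `|u i - w i| @[i --> F] --> 0.
Proof.
move=> BH Bs Bu e_gt0 e0 xx.
have fin i : dist_set (u i) (B x) \is a fin_num.
  rewrite ge0_fin_numE; last by apply: le_ereal_inf_tmp => _ [b _ <-].
  have [b Bb] := Bs x.
  apply: (@le_lt_trans _ _ `|u i - b|%:E); last exact: ltry.
  by apply: ge_ereal_inf; exists `|u i - b|%:E => //; exists b.
have /choice[w hw] : forall i, exists w, B x w /\
    (`|u i - w|%:E < dist_set (u i) (B x) + (e i)%:E)%E.
  move=> i.
  by have [_ [b Bb <-] ub] := lb_ereal_inf_adherent (e_gt0 i) (fin i); exists b.
exists w => [i|]; first by case: (hw i).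
apply/cvgrPdist_lt => r r0.
have r20 : 0 < r / 2 by rewrite divr_gt0.
have [delta d0 hd] := BH x _ r20.
near=> i; rewrite sub0r normrN normr_id.
have [_] := hw i; rewrite -lte_fin => /lt_trans; apply.
have ud : (dist_set (u i) (B x) < (r / 2)%:E)%E.
  have : (hausdorff_dist (B x) (B (x_ i)) < (r / 2)%:E)%E.
    by apply: hd; near: i; exact: cvgr_dist_lt xx _ d0.
  apply: le_lt_trans; rewrite /hausdorff_dist le_max; apply/orP; right.
  by apply: ereal_sup_ubound; exists (u i).
rewrite [r]splitr EFinD lteD// lte_fin; near: i; exact: cvgr_lt e0 _ r20.
Unshelve. all: by end_near. Qed.

(** Approximate variational inequalities along [x_] yield an exact one at the
    limit, with a single multiplier [v] valid for all test points. *)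
Lemma approx_variational_limit C (f : H -> R) B (x_ u : I -> H) (e : I -> R) x :
  continuous f -> strict_map B -> weakly_compact_valued B -> H_continuous B ->
  (forall i, B (x_ i) (u i)) -> (forall i, 0 < e i) ->
  e i @[i --> F] --> 0 -> x_ i @[i --> F] --> x ->
  (forall i z, C z -> inner (u i) (x_ i - z) + f (x_ i) - f z <= e i) ->
  exists2 v, B x v & forall z, C z -> inner v (x - z) + f x - f z <= 0.
Proof.
move=> fc Bs Bwc BH Bu e_gt0 e0 xx ue.
have [w Bw uw0] := H_continuous_selection BH Bs Bu e_gt0 e0 xx.
have [K hK] := weakly_compact_bounded (Bwc x).
have [|v [Bv wv]] := Bwc x (w @ F); first exact: (@filterE _ F).
exists v => // z Cz; apply/ler_addgt0Pr => d d0; rewrite add0r.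
suff : inner v (x - z) <= d - f x + f z by lra.
apply: (weak_cluster_inner_le wv).
(* [gap i] bounds the total error made when [u i], [x_ i] are replaced by
   [w i], [x] in the [i]-th inequality *)
pose gap i := `|u i - w i| * `|x_ i - z| + K * `|x - x_ i| + `|f (x_ i) - f x| + e i.
have gap0 : gap i @[i --> F] --> 0.
  have -> : 0 = 0 * `|x - z| + K * `|x - x| + `|f x - f x| + 0.
    by rewrite !subrr !normr0 mul0r mulr0 !addr0.
  have fx : f (x_ i) @[i --> F] --> f x by exact: continuous_cvg (fc x) xx.
  apply: cvgD => //; apply: cvgD.
    apply: cvgD.
      apply: cvgM => //; apply: cvg_norm; apply: cvgB => //; exact: cvg_cst.
    apply: cvgM; first exact: cvg_cst.
    by apply: cvg_norm; apply: cvgB => //; exact: cvg_cst.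
  by apply: cvg_norm; apply: cvgB => //; exact: cvg_cst.
apply: filterS (cvgr_lt _ gap0 _ d0) => i; rewrite /gap => gi.
have -> : inner (w i) (x - z) = inner (u i) (x_ i - z)
    - inner (u i - w i) (x_ i - z) + inner (w i) (x - x_ i).
  by rewrite !innerBr !innerBl; ring.
have := ue i z Cz.
have := cauchy_schwarz (u i - w i) (x_ i - z); rewrite ler_norml => /andP[+ _].
have := le_trans (ler_norm _) (cauchy_schwarz (w i) (x - x_ i)).
have : `|w i| * `|x - x_ i| <= K * `|x - x_ i| by rewrite ler_wpM2r ?hK.
have : - `|f (x_ i) - f x| <= f (x_ i) - f x by rewrite lerNl -normrN ler_norm.
by lra.
Qed.

End limits.

(** * The Kuratowski measure of noncompactness *)

Section kuratowski.
Context {R : realType} {H1 H2 : hilbertType R}.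
Implicit Types (p q : H1 * H2) (M : set (H1 * H2)).

Lemma le_norm_prod_norm p : `|p| <= prod_norm p.
Proof.
rewrite prod_normE /prod_norm /prod_inner !inner_sqr ge_max; apply/andP; split.
  by rewrite -[leLHS]ger0_norm// -sqrtr_sqr ler_wsqrtr// lerDl sqr_ge0.
by rewrite -[leLHS]ger0_norm// -sqrtr_sqr ler_wsqrtr// lerDr sqr_ge0.
Qed.

Lemma prod_norm_le_norm p : prod_norm p <= 2 * `|p|.
Proof.
have p1 : `|p.1| <= `|p| by rewrite prod_normE le_max lexx.
have p2 : `|p.2| <= `|p| by rewrite prod_normE le_max lexx orbT.
rewrite /prod_norm /prod_inner !inner_sqr -[leRHS]ger0_norm ?mulr_ge0//.
rewrite -sqrtr_sqr ler_wsqrtr// exprMn.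
have : `|p.1| ^+ 2 <= `|p| ^+ 2 by rewrite ler_sqr ?nnegrE.
have : `|p.2| ^+ 2 <= `|p| ^+ 2 by rewrite ler_sqr ?nnegrE.
have := sqr_ge0 `|p|.
by lra.
Qed.

(** [M] is covered by finitely many sets of diameter less than [r]. *)
Definition small_cover (r : R) M := exists (n : nat) (F : 'I_n -> set (H1 * H2)),
  M `<=` \bigcup_i F i /\ forall i, (diam (F i) < r%:E)%E.

Lemma kuratowski_ge0 M : (0 <= kuratowski M)%E.
Proof. by apply: le_ereal_inf_tmp => _ [e [e0 _] <-]; rewrite lee_fin ltW. Qed.

Lemma le_kuratowski M M' : M `<=` M' -> (kuratowski M <= kuratowski M')%E.
Proof.
move=> MM'; apply: ereal_inf_le_tmp => _ [e [e0 [n [F [FM Fd]]]] <-].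
by exists e => //; split => //; exists n, F; split => //; exact: subset_trans FM.
Qed.

Lemma kuratowski_le (r : R) M : 0 < r -> small_cover r M ->
  (kuratowski M <= r%:E)%E.
Proof. by move=> r0 Mr; apply: ereal_inf_lbound; exists r. Qed.

Lemma kuratowski_lt (r : R) M : (kuratowski M < r%:E)%E -> small_cover r M.
Proof.
move=> /ereal_inf_lt[_ [e [e0 [n [F [FM Fd]]]] <-]] er.
by exists n, F; split => // i; exact: lt_trans er.
Qed.

Lemma kuratowski_cvg0P (S : R -> set (H1 * H2)) :
  (forall e e', e <= e' -> S e `<=` S e') ->
  kuratowski (S e) @[e --> 0^'+] --> 0%E <->
  forall r, 0 < r -> exists2 e, 0 < e & small_cover r (S e).
Proof.
move=> S_mono; split=> [S0 r r0|Sc].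
  have /filter_ex[e [e0 er]] : \forall e \near (0 : R)^'+,
      0 < e /\ (kuratowski (S e) < r%:E)%E.
    apply: filterI; first exact: nbhs_right_gt.
    apply: (S0 [set y | (y < r%:E)%E]); apply: open_nbhs_nbhs; split.
      exact: open_ereal_lt_ereal.
    by rewrite /= lte_fin.
  by exists e => //; exact: kuratowski_lt.
have := @nondecreasing_at_right_cvge R (fun e => kuratowski (S e)) 0 +oo%O isT.
have -> : ereal_inf [set kuratowski (S x) | x in `]0, +oo[] = 0%E.
  apply/eqP; rewrite eq_le; apply/andP; split; last first.
    by apply: le_ereal_inf_tmp => _ [e _ <-]; exact: kuratowski_ge0.
  apply/lee_addgt0Pr => r r0; rewrite add0e; have [e e0 er] := Sc r r0.
  apply: ge_ereal_inf; exists (kuratowski (S e)); last exact: kuratowski_le.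
  by exists e => //; rewrite /= in_itv/= e0.
by apply => e e' _ _ ee'; apply/le_kuratowski/S_mono.
Qed.

(** Otherwise the balls of radius [r / 8] (for the maximum norm) around [s]
    would cover [M]; their diameter in the Hilbert norm is at most [r / 2]. *)
Lemma separated_point (r : R) M (s : seq (H1 * H2)) : 0 < r ->
  ~ small_cover r M ->
  exists p, M p /\ forall q, q \in s -> r / 8 <= `|p - q|.
Proof.
move=> r0; apply: contra_notP => nsep.
have near_s p : M p -> exists2 q, q \in s & `|p - q| < r / 8.
  move=> Mp; apply: contrapT => far; apply: nsep; exists p; split => // q qs.
  by rewrite leNgt; apply/negP => pq; apply: far; exists q.
exists (size s), (fun i => [set p | `|p - nth 0 s i| < r / 8]); split.
  move=> p /near_s[q qs pq].
  have qi : (index q s < size s)%N by rewrite index_mem.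
  by exists (Ordinal qi) => //=; rewrite nth_index.
move=> i; apply: (@le_lt_trans _ _ (r / 2)%:E); last first.
  by rewrite lte_fin ltr_pdivrMr// ltr_pMr// ltr1n.
apply: ge_ereal_sup => _ [[p q] [/= pi qi] <-]; rewrite lee_fin.
apply: le_trans (prod_norm_le_norm _) _.
move: pi qi (ler_distD (nth 0 s i) p q) => /=; rewrite (distrC q).
by lra.
Qed.

End kuratowski.

(** * Ultrafilters and subsequences *)

Section subsequences.
Context {R : realType}.

Lemma ultra_bigcup {T I : Type} (U : set_system T) (p : T -> I) n
    (F : 'I_n -> set I) :
  UltraFilter U -> (\forall t \near U, (\bigcup_i F i) (p t)) ->
  exists i, \forall t \near U, F i (p t).
Proof.
move=> UU Ucup; apply: contrapT => /forallNP nF.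
have UP : ProperFilter U := ultra_proper.
have /filter_forall nU : forall i : 'I_n, \forall t \near U, ~ F i (p t).
  by move=> i; have [/nF//|] := in_ultra_setVsetC [set t | F i (p t)] UU.
by have [t [[i _ Fi] nFt]] := @filter_ex _ U _ _ (filterI Ucup nU); exact: nFt Fi.
Qed.

(** A point approached infinitely often by a sequence is the limit of one of
    its subsequences. *)
Lemma clustering_subsequence {V : normedModType R} (p : nat -> V) (l : V) :
  (forall N (r : R), 0 < r -> exists m, (N <= m)%N /\ `|p m - l| < r) ->
  exists2 k : nat -> nat, increasing_seq k & `|p (k n) - l| @[n --> \oo] --> (0 : R).
Proof.
move=> pl.
have /choice[c hc] : forall Nn : nat * nat, exists m, (Nn.1 <= m)%N /\
    `|p m - l| < Nn.2.+1%:R^-1.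
  by move=> [N n]; apply: pl; rewrite invr_gt0.
pose k := fix k n := if n is m.+1 then c ((k m).+1, n) else c (0%N, 0%N).
exists k.
  by apply/increasing_seqP => n; rewrite ltEnat /=; case: (hc ((k n).+1, n.+1)).
apply: (@squeeze_cvgr _ _ _ _ (cst 0) (fun n => n.+1%:R^-1)).
- apply: nearW => n; rewrite normr_ge0/= ltW//; case: n => [|n] /=.
    by case: (hc (0%N, 0%N)).
  by case: (hc ((k n).+1, n.+1)).
- exact: cvg_cst.
- exact: cvg_harmonic.
Qed.

Lemma separated_no_subsequence {V : normedModType R} (p : nat -> V) (r : R) :
  0 < r -> (forall i j, (i < j)%N -> r <= `|p j - p i|) ->
  forall k l, increasing_seq k -> ~ `|p (k n) - l| @[n --> \oo] --> (0 : R).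
Proof.
move=> r0 psep k l /increasing_seqP kinc pkl.
have r20 : 0 < r / 2 by rewrite divr_gt0.
have [N _ hN] := cvgr_lt _ pkl _ r20.
have := psep _ _ (kinc N); have := hN N (leqnn N); have := hN N.+1 (leqnSn N) => /=.
by have := ler_distD l (p (k N.+1)) (p (k N)); rewrite (distrC l); lra.
Qed.

End subsequences.

(** * Well-posedness of the split variational inequality *)

Section smvip.
Context {R : realType} {H1 H2 : hilbertType R}.
Variables (C : set H1) (Q : set H2) (f : H1 -> R) (g : H2 -> R).
Variables (B1 : H1 -> set H1) (B2 : H2 -> set H2) (A : {linear H1 -> H2}).
Local Notation S := (smvip_sol C Q f g B1 B2 A).
Local Notation S_ := (smvip_approx C Q f g B1 B2 A).

Lemma dist_set_mem (H : hilbertType R) (x : H) (M : set H) (e : R) :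
  M x -> 0 <= e -> (dist_set x M <= e%:E)%E.
Proof.
move=> Mx e0; apply: ge_ereal_inf; exists `|x - x|%:E; first by exists x.
by rewrite subrr normr0 lee_fin.
Qed.

Lemma smvip_sol_approx (e : R) : 0 <= e -> S `<=` S_ e.
Proof.
move=> e0 p [u [v [[Bu Bv Cp Qp pA] [hu hv]]]]; split.
- exact: dist_set_mem.
- exact: dist_set_mem.
- by rewrite pA subrr normr0.
- exists u, v; split => // z zin; first exact: le_trans (hu z zin) _.
  exact: le_trans (hv z zin) _.
Qed.

Lemma le_smvip_approx (e e' : R) : e <= e' -> S_ e `<=` S_ e'.
Proof.
move=> ee' p [pC pQ pA [u [v [Bu Bv hu hv]]]]; split.
- by apply: le_trans pC _; rewrite lee_fin.
- by apply: le_trans pQ _; rewrite lee_fin.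
- exact: le_trans pA _.
- exists u, v; split => // z zin; first exact: le_trans (hu z zin) _.
  exact: le_trans (hv z zin) _.
Qed.

Lemma smvip_approx_choice (p : nat -> H1 * H2) (e : nat -> R) :
  (forall n, S_ (e n) (p n)) ->
  exists (u : nat -> H1) (v : nat -> H2), forall n,
    [/\ B1 (p n).1 (u n), B2 (p n).2 (v n),
      forall x, C x -> inner (u n) ((p n).1 - x) + f (p n).1 - f x <= e n &
      forall y, Q y -> inner (v n) ((p n).2 - y) + g (p n).2 - g y <= e n].
Proof.
move=> pe; have /choice[u /choice[v uv]] : forall n, exists a : H1, exists b : H2,
    [/\ B1 (p n).1 a, B2 (p n).2 b,
      forall x, C x -> inner a ((p n).1 - x) + f (p n).1 - f x <= e n &
      forall y, Q y -> inner b ((p n).2 - y) + g (p n).2 - g y <= e n].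
  by move=> n; have [_ _ _] := pe n.
by exists u, v.
Qed.

Lemma generalized_approximating_seqP (p : nat -> H1 * H2) :
  generalized_approximating_seq C Q f g B1 B2 A p <->
  exists e : nat -> R, [/\ forall n, 0 < e n, e @ \oo --> (0 : R) &
    forall n, S_ (e n) (p n)].
Proof.
split=> [[u [v [e [[Bu Bv e_gt0 e0] h]]]]|[e [e_gt0 e0 pe]]].
  exists e; split => // n; have [pC pQ pA hu hv] := h n.
  by split => //; exists (u n), (v n).
have [u [v uv]] := smvip_approx_choice pe.
exists u, v, e; split; first by split => // n; case: (uv n).
by move=> n; have [? ? ? _] := pe n; have [_ _ ? ?] := uv n; split.
Qed.

Lemma well_posed_small_cover :
  LP_well_posed_generalized C Q f g B1 B2 A ->
  forall r : R, 0 < r -> exists2 e, 0 < e & small_cover r (S_ e).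
Proof.
move=> [_ wp] r r0; apply: contrapT => ncover.
have /choice[c hc] : forall sn : seq (H1 * H2) * nat, exists p,
    S_ sn.2.+1%:R^-1 p /\ forall q, q \in sn.1 -> r / 8 <= `|p - q|.
  move=> [s n]; apply: separated_point r0 _ => cover.
  by apply: ncover; exists n.+1%:R^-1.
(* [hist n] lists the first [n] points, [p n] is chosen away from them *)
pose hist := fix hist n := if n is m.+1 then c (hist m, m) :: hist m else [::].
pose p n := c (hist n, n).
have hist_p i j : (i < j)%N -> p i \in hist j.
  elim: j => // j IH; rewrite ltnS leq_eqVlt inE => /predU1P[->|/IH ->].
    by rewrite eqxx.
  by rewrite orbT.
have psep i j : (i < j)%N -> r / 8 <= `|p j - p i|.
  by move=> ij; apply: (hc (hist j, j)).2; exact: hist_p.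
have r80 : 0 < r / 8 by rewrite divr_gt0.
have [|k kinc [l _ pkl]] := wp p.
  apply/generalized_approximating_seqP; exists (fun n => n.+1%:R^-1).
  by split => [//||n]; [exact: cvg_harmonic|exact: (hc (hist n, n)).1].
apply: (separated_no_subsequence r80 psep kinc (l := l)).
apply: squeeze_cvgr (cvg_cst 0) pkl.
by apply: nearW => n; rewrite normr_ge0 le_norm_prod_norm.
Qed.

Hypotheses (C_closed : closed C) (Q_closed : closed Q).
Hypotheses (f_cont : continuous f) (g_cont : continuous g).
Hypotheses (B1s : strict_map B1) (B1wc : weakly_compact_valued B1).
Hypotheses (B2s : strict_map B2) (B2wc : weakly_compact_valued B2).
Hypotheses (B1H : H_continuous B1) (B2H : H_continuous B2).
Hypothesis A_bounded : bounded_operator A.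

Lemma bounded_operator_continuous : continuous A.
Proof.
have [k hk] := A_bounded.
have k0 : 0 < `|k| + 1 by rewrite ltr_wpDl.
move=> x; apply/cvgrPdist_lt => e e0; near=> y.
rewrite -linearB (le_lt_trans (hk _))//.
apply: (@le_lt_trans _ _ ((`|k| + 1) * `|x - y|)).
  by rewrite ler_wpM2r// (le_trans (ler_norm k))// lerDl.
rewrite -ltr_pdivlMl// mulrC; near: y; apply: cvgr_dist_lt; first exact: cvg_id.
exact: divr_gt0.
Unshelve. all: by end_near. Qed.

Lemma smvip_approx_limit (F : set_system nat) {FF : ProperFilter F}
    (p : nat -> H1 * H2) (e : nat -> R) (l : H1 * H2) :
  (forall n, 0 < e n) -> e n @[n --> F] --> 0 -> (forall n, S_ (e n) (p n)) ->
  (p n).1 @[n --> F] --> l.1 -> (p n).2 @[n --> F] --> l.2 -> S l.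
Proof.
move=> e_gt0 e0 pe p1 p2.
have [u [v uv]] := smvip_approx_choice pe.
have [n|n|u' Bu hu] :=
  approx_variational_limit (C := C) f_cont B1s B1wc B1H _ e_gt0 e0 p1 _ (u := u).
- by case: (uv n).
- by case: (uv n).
have [n|n|v' Bv hv] :=
  approx_variational_limit (C := Q) g_cont B2s B2wc B2H _ e_gt0 e0 p2 _ (u := v).
- by case: (uv n).
- by case: (uv n).
exists u', v'; split => //; split => //.
- by apply: dist_set_cvg0_mem C_closed _ e0 p1 => n; case: (pe n).
- by apply: dist_set_cvg0_mem Q_closed _ e0 p2 => n; case: (pe n).
have Ap : A (p n).1 @[n --> F] --> A l.1.
  exact: (continuous_cvg _ (@bounded_operator_continuous l.1) p1).
apply/eqP; rewrite -subr_eq0 -normr_le0.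
apply: (ler_cvg_to (cvg_norm (cvgB p2 Ap)) e0).
by apply: nearW => n; case: (pe n).
Qed.

Lemma approx_subsequence (p : nat -> H1 * H2) (e : nat -> R) :
  (forall r : R, 0 < r -> exists2 e, 0 < e & small_cover r (S_ e)) ->
  (forall n, 0 < e n) -> e @ \oo --> (0 : R) -> (forall n, S_ (e n) (p n)) ->
  exists2 k : nat -> nat, increasing_seq k &
  exists2 l, S l & prod_norm (p (k n) - l) @[n --> \oo] --> (0 : R).
Proof.
move=> Sc e_gt0 e0 pe.
have [U [UU ooU]] := ultraFilterLemma eventually_filter.
have UP : ProperFilter U := ultra_proper.
(* [p] is Cauchy along [U]: one piece of a fine cover contains [p n] for
   [U]-almost all [n] *)
have small r : 0 < r -> exists q, \forall n \near U, prod_norm (q - p n) < r.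
  move=> r0; have [d d0 [m [F [FS Fr]]]] := Sc r r0.
  have /(ultra_bigcup UU)[i Ui] : \forall n \near U, (\bigcup_i F i) (p n).
    apply: ooU; apply: filterS (cvgr_lt _ e0 _ d0) => n en.
    by apply: FS; apply: le_smvip_approx (pe n); exact: ltW.
  have [n0 Fi0] := @filter_ex _ U _ _ Ui.
  exists (p n0); apply: (@filterS _ U _ _ _ _ Ui) => n Fi.
  rewrite -lte_fin; apply: le_lt_trans (Fr i); apply: ereal_sup_ubound.
  by exists (p n0, p n).
have /cauchy_cvg/cvg_ex[l1 /= p1] : cauchy ((p n).1 @[n --> U]).
  apply/cauchyP => r /small[q Uq]; exists q.1.
  apply: (@filterS _ U _ _ _ _ Uq) => n qn; rewrite -ball_normE /=.
  apply: le_lt_trans qn; apply: le_trans (le_norm_prod_norm _).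
  by rewrite prod_normE le_max lexx.
have /cauchy_cvg/cvg_ex[l2 /= p2] : cauchy ((p n).2 @[n --> U]).
  apply/cauchyP => r /small[q Uq]; exists q.2.
  apply: (@filterS _ U _ _ _ _ Uq) => n qn; rewrite -ball_normE /=.
  apply: le_lt_trans qn; apply: le_trans (le_norm_prod_norm _).
  by rewrite prod_normE le_max lexx orbT.
have Sl : S (l1, l2).
  have Ue0 : e n @[n --> U] --> 0 by move=> B /e0; exact: ooU.
  exact: (@smvip_approx_limit _ _ _ _ (l1, l2) e_gt0 Ue0 pe p1 p2).
have [|k kinc pkl] := @clustering_subsequence R (H1 * H2)%type p (l1, l2).
  move=> N r r0.
  have UN : \forall n \near U, (N <= n)%N by apply: ooU; exact: nbhs_infty_ge.
  have U1 : \forall n \near U, `|l1 - (p n).1| < r by exact: cvgr_dist_lt p1 _ r0.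
  have U2 : \forall n \near U, `|l2 - (p n).2| < r by exact: cvgr_dist_lt p2 _ r0.
  have [m [Nm [m1 m2]]] := @filter_ex _ U _ _ (filterI UN (filterI U1 U2)).
  by exists m; split => //; rewrite distrC prod_normE gt_max m1 m2.
exists k => //; exists (l1, l2) => //.
apply: (@squeeze_cvgr _ _ _ _ (cst 0) (fun n => 2 * `|p (k n) - (l1, l2)|)).
- by apply: nearW => n; rewrite sqrtr_ge0 prod_norm_le_norm.
- exact: cvg_cst.
- by rewrite -[X in _ --> X](mulr0 2); apply: cvgM => //; exact: cvg_cst.
Qed.

End smvip.

Unset Implicit Arguments.
Set Strict Implicit.
Set Printing Implicit Defensive.

Theorem theorem7 (R : realType) (H1 H2 : hilbertType R)
  (C : set H1) (Q : set H2) (f : H1 -> R) (g : H2 -> R)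
  (B1 : H1 -> set H1) (B2 : H2 -> set H2) (A : {linear H1 -> H2}) :
  C !=set0 -> closed C -> convex_set C ->
  Q !=set0 -> closed Q -> convex_set Q ->
  continuous f -> continuous g ->
  strict_map B1 -> weakly_compact_valued B1 -> H_continuous B1 ->
  strict_map B2 -> weakly_compact_valued B2 -> H_continuous B2 ->
  bounded_operator A ->
  LP_well_posed_generalized C Q f g B1 B2 A <->
  (forall e : R, 0 < e -> smvip_approx C Q f g B1 B2 A e !=set0) /\
  kuratowski (smvip_approx C Q f g B1 B2 A e) @[e --> 0^'+] --> 0%E.
Proof.
move=> _ C_closed _ _ Q_closed _ f_cont g_cont.
move=> B1s B1wc B1H B2s B2wc B2H A_bounded.
rewrite kuratowski_cvg0P; last exact: le_smvip_approx.
split=> [wp|[Sn0 Sc]].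
  split; last exact: well_posed_small_cover.
  have [[p Sp] _] := wp.
  by move=> e /ltW e0; exists p; exact: smvip_sol_approx Sp.
have sub p e := approx_subsequence (p := p) (e := e) C_closed Q_closed f_cont g_cont
  B1s B1wc B2s B2wc B1H B2H A_bounded Sc.
split=> [|p /generalized_approximating_seqP[e [e_gt0 e0 pe]]]; last first.
  exact: sub e_gt0 e0 pe.
have /choice[p hp] : forall n : nat, exists p,
    smvip_approx C Q f g B1 B2 A n.+1%:R^-1 p.
  by move=> n; apply: Sn0; rewrite invr_gt0.
have [||_ _ [l Sl _]] := sub p _ _ _ hp.
- by move=> n.
- exact: cvg_harmonic.
- by exists l.
Qed.
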